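(* A monotone map $f\colon P'\to P$ of finite posets is a subdivision map if and only if there exists a PL homeomorphism $h\colon|P'|\to|P|$ such that $h^{-1}(|\lceil p\rceil|)=|f^{-1}(\lceil p\rceil)|$ for each $p\in P$.
   Context: All posets are finite. For a poset $P$, $|P|$ denotes the polyhedron given by the geometric realization of the simplicial complex of nonempty chains of $P$; for a subposet $Q\subset P$, $|Q|$ is regarded as a subpolyhedron of $|P|$. All maps and homeomorphisms of polyhedra are PL. For $p\in P$ let $\lceil p\rceil=\{q\in P: q\le p\}$ and $\partial\lceil p\rceil=\{q\in P: q<p\}$. For a poset $X$, $CX$ is the poset obtained from $X$ by adjoining a greatest element (so $C\emptyset$ is a singleton). A monotone map $f\colon P'\to P$ between posets is a subdivision map if for each $p\in P$ the polyhedron $|f^{-1}(\lceil p\rceil)|$ is homeomorphic to $|C f^{-1}(\partial\lceil p\rceil)|$ by a homeomorphism that is the identity on $|f^{-1}(\partial\lceil p\rceil)|$. *)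

(* Defs.v *)
From HB Require Import structures.
From mathcomp Require Import all_boot all_order all_algebra.
From mathcomp Require Import boolp classical_sets functions reals.

Set Implicit Arguments.
Unset Strict Implicit.
Unset Printing Implicit Defensive.

Import Order.TTheory GRing.Theory Num.Theory.

Local Open Scope classical_set_scope.
Local Open Scope ring_scope.

Section PiecewiseLinear.
Variable R : realType.

Definition affine_map (U V : lmodType R) (g : U -> V) : Prop :=
  exists (L : {linear U -> V}) (c : V), forall x, g x = L x + c.

(* Finite intersections of closed half-spaces (equations are pairs of opposite
   inequalities). *)
Definition convex_polyhedral (U : lmodType R) (C : set U) : Prop :=
  exists (n : nat) (g : 'I_n -> U -> R^o),
    (forall i, affine_map (g i)) /\ C = [set x | forall i, 0 <= g i x].

(* The ambient spaces used below are finite-dimensional, so the pieces are closed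
   and, being finite in number, make [f]
   continuous on [A]; when [A] is bounded they are compact convex cells. The
   values of [f] outside [A] are irrelevant. *)
Definition pl_map (U V : lmodType R) (A : set U) (f : U -> V) : Prop :=
  exists (n : nat) (C : 'I_n -> set U),
    [/\ forall i, convex_polyhedral (C i),
        A = \bigcup_i C i &
        forall i, exists2 g : U -> V,
          affine_map g & forall x, C i x -> f x = g x].

Definition pl_homeo (U V : lmodType R) (A : set U) (B : set V) (f : U -> V) :
    Prop :=
  [/\ set_bij A B f,
      pl_map A f &
      exists2 g : V -> U, pl_map B g & forall x, A x -> g (f x) = x].

End PiecewiseLinear.

Section Realization.
Variable R : realType.
Context {d : Order.disp_t} {P : finPOrderType d}.

Definition is_chain (c : {set P}) : Prop :=
  forall p q, p \in c -> q \in c -> (p >=< q)%O.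

Definition bary_supp (x : {ffun P -> R^o}) : {set P} := [set p | x p != 0]%SET.

(* [|Q|] as a subpolyhedron of [|P|], in barycentric coordinates: the open
   simplex containing a point is given by the support of its coordinates. *)
Definition realization (Q : {set P}) : set {ffun P -> R^o} :=
  [set x : {ffun P -> R^o} | [/\ forall p, 0 <= x p,
               \sum_p x p = 1,
               bary_supp x \subset Q &
               is_chain (bary_supp x)]].

End Realization.

Arguments realization R {d P} Q.

Definition cone (T : Type) : Type := option T.

HB.instance Definition _ (T : finType) := Finite.on (cone T).

Section Cone.
Context {d : Order.disp_t} {P : finPOrderType d}.

Definition cone_le (a b : cone P) : bool :=
  match a, b with
  | _, None => true
  | None, Some _ => false
  | Some p, Some q => (p <= q)%O
  end.

Lemma cone_le_refl : reflexive cone_le.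
Proof. by case=> [p|] //=. Qed.

Lemma cone_le_anti : antisymmetric cone_le.
Proof. by move=> [p|] [q|] //= /le_anti ->. Qed.

Lemma cone_le_trans : transitive cone_le.
Proof. by move=> [p|] [q|] [r|] //=; apply: le_trans. Qed.

HB.instance Definition _ :=
  Order.Le_isPOrder.Build d (cone P) cone_le_refl cone_le_anti cone_le_trans.

(* The cone [CX] over a subposet [X] of [P], as a subposet of [CP]. *)
Definition cone_set (X : {set P}) : {set cone P} := (None |: [set Some p | p in X])%SET.

(* The inclusion of [|P|] into [|CP|]: coordinate 0 at the cone point. *)
Definition cone_incl (R : realType) (x : {ffun P -> R^o}) :
    {ffun cone P -> R^o} :=
  [ffun a : cone P => (if a is Some p then x p else 0) : R^o].

End Cone.

Section Subdivision.
Context {d : Order.disp_t} {P : finPOrderType d}.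

Definition principal (p : P) : {set P} := [set q | (q <= p)%O]%SET.

Definition boundary (p : P) : {set P} := [set q | (q < p)%O]%SET.

End Subdivision.

Definition subdivision_map (R : realType) (d' d : Order.disp_t)
    (P' : finPOrderType d') (P : finPOrderType d) (f : P' -> P) : Prop :=
  forall p : P,
    exists2 h : {ffun P' -> R^o} -> {ffun cone P' -> R^o},
      pl_homeo (realization R (f @^-1: principal p))
               (realization R (cone_set (f @^-1: boundary p))) h &
      forall x, realization R (f @^-1: boundary p) x -> h x = cone_incl x.

(* Main.v *)
Require Import Defs.
From HB Require Import structures.
From mathcomp Require Import all_boot all_order all_algebra.
From mathcomp Require Import boolp classical_sets functions reals.

(** Two facts about cones carry the proof. First, every principal down-set
[principal p] is its boundary with a greatest element added, so its realization
is a cone over [realization (boundary p)] with apex [p]. Secondly, a PL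
isomorphism between two realizations extends to the cones over them, by sending
apex to apex and extending linearly along rays ([pl_iso_cone]). The extension is
PL although the radial projection [base] of a cone to its base is not: scaling
an affine map of the base by [1 - z v], where [z v] is the coordinate at the apex,
clears the denominator ([affine_homogenize]).

If [h] is a PL isomorphism of the realizations that matches the pieces over the
principal down-sets, then it also matches the pieces over their boundaries, as
the support of a point is a nonempty chain and hence lies in the principal
down-set of its greatest element. Extending the inverse of [h] over the boundary
of [p] to the cones and composing with [h] gives the homeomorphism which a
subdivision map requires at [p]; it is the identity on the boundary because
[h] and its inverse cancel there ([stratified_iso_subdivision]).

Conversely, [h] is built one element at a time over growing down-sets
([subdivision_stratified_iso]). When a maximal element [p] of a down-set [Q] is
added, the homeomorphism given at [p] followed by the cone of the map already
built over the boundary of [p] covers the new piece. Maximality of [p] and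
monotonicity of [f] make the old and the new pieces cover everything over [Q]
and meet exactly over the boundary of [p], where the two maps agree; so they
glue, and so do their inverses. *)

Set Implicit Arguments.
Unset Strict Implicit.
Unset Printing Implicit Defensive.

Import Order.TTheory GRing.Theory Num.Theory.

Local Open Scope classical_set_scope.
Local Open Scope ring_scope.

(** * Affine maps and polyhedral sets *)

Section Affine.
Variable R : realType.
Implicit Types U V W : lmodType R.

Lemma affine_linear U V (f : U -> V) : linear f -> affine_map f.
Proof.
move=> lin_f.
pose F : {linear U -> V} := HB.pack f (GRing.isLinear.Build _ _ _ _ f lin_f).
by exists F, 0 => x; rewrite addr0.
Qed.

Lemma affine_cst U V (c : V) : affine_map (fun _ : U => c).
Proof. by exists \0, c => x; rewrite add0r. Qed.

Lemma affine_comp U V W (g : V -> W) (f : U -> V) :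
  affine_map g -> affine_map f -> affine_map (g \o f).
Proof.
move=> [L [c gE]] [M [e fE]]; exists (L \o M), (L e + c) => x /=.
by rewrite gE fE linearD addrA.
Qed.

Lemma affine_add U V (f g : U -> V) :
  affine_map f -> affine_map g -> affine_map (fun x => f x + g x).
Proof.
move=> [L [c fE]] [M [e gE]]; exists (L \+ M), (c + e) => x /=.
by rewrite fE gE addrACA.
Qed.

Lemma affine_opp U V (f : U -> V) :
  affine_map f -> affine_map (fun x => - f x).
Proof.
move=> [L [c fE]]; exists (\- L), (- c) => x /=.
by rewrite fE opprD.
Qed.

Lemma affine_scale U V (f : U -> R^o) (w : V) :
  affine_map f -> affine_map (fun x => (f x : R) *: w).
Proof.
move=> af.
have lin_w : linear (fun a : R^o => (a : R) *: w).
  by move=> a x y; rewrite scalerDl scalerA.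
exact: (affine_comp (affine_linear lin_w) af).
Qed.

Lemma affine_coord (I : finType) (i : I) :
  affine_map (fun x : {ffun I -> R^o} => x i).
Proof. by apply: affine_linear => a x y; rewrite !ffunE. Qed.

Lemma affine_sum (I : finType) :
  affine_map (fun x : {ffun I -> R^o} => \sum_i x i).
Proof.
apply: affine_linear => a x y; rewrite scaler_sumr -big_split /=.
by apply: eq_bigr => i _; rewrite !ffunE.
Qed.

Lemma polyhedral_fin U (I : finType) (g : I -> U -> R^o) :
  (forall i, affine_map (g i)) ->
  convex_polyhedral [set x | forall i, 0 <= g i x].
Proof.
move=> ag; exists #|I|, (fun k => g (enum_val k)).
split=> [k|]; first exact: ag.
apply/seteqP; split=> x /= gx i; first exact: gx.
by rewrite -(enum_rankK i).
Qed.

Lemma polyhedral_ge0 U (g : U -> R^o) :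
  affine_map g -> convex_polyhedral [set x | 0 <= g x].
Proof.
move=> ag; have -> : [set x | 0 <= g x] = [set x | unit -> 0 <= g x].
  by apply/seteqP; split=> x /=; [move=> + _ | apply].
exact: (polyhedral_fin (I := unit) (g := fun=> g)).
Qed.

Lemma polyhedralI U (A B : set U) :
  convex_polyhedral A -> convex_polyhedral B -> convex_polyhedral (A `&` B).
Proof.
move=> [m [g [ag ->]]] [n [h [ah ->]]].
pose k (i : 'I_m + 'I_n) := match i with inl i => g i | inr j => h j end.
suff <- : [set x | forall i, 0 <= k i x] =
  [set x | forall i, 0 <= g i x] `&` [set x | forall i, 0 <= h i x].
  by apply: polyhedral_fin; case.
apply/seteqP; split=> x /=.
  by move=> kx; split=> i; [exact: (kx (inl i)) | exact: (kx (inr i))].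
by move=> [gx hx] [] i; [exact: gx | exact: hx].
Qed.

Lemma polyhedral_eq0 U (g : U -> R^o) :
  affine_map g -> convex_polyhedral [set x | g x = 0].
Proof.
move=> ag.
have -> : [set x | g x = 0] = [set x | 0 <= g x] `&` [set x | 0 <= - g x].
  apply/seteqP; split=> x /=; first by move=> ->; rewrite oppr0.
  by move=> [? gx]; apply/le_anti; rewrite -oppr_ge0 gx.
by apply: polyhedralI; apply: polyhedral_ge0 => //; apply: affine_opp.
Qed.

Lemma polyhedral_preimage U V (f : U -> V) (B : set V) :
  affine_map f -> convex_polyhedral B -> convex_polyhedral (f @^-1` B).
Proof.
move=> af [n [g [ag ->]]].
apply: (polyhedral_fin (g := fun i => g i \o f)) => i; exact: affine_comp.
Qed.

Lemma polyhedral_simplex (I : finType) :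
  convex_polyhedral
    [set x : {ffun I -> R^o} | (forall i, 0 <= x i) /\ \sum_i x i = 1].
Proof.
apply: (@polyhedralI _ [set x : {ffun I -> R^o} | forall i, 0 <= x i]
          [set x : {ffun I -> R^o} | \sum_i x i = 1]).
  by apply: (polyhedral_fin (g := fun i (x : {ffun I -> R^o}) => x i)) => i;
    apply: affine_coord.
have -> : [set x : {ffun I -> R^o} | \sum_i x i = 1] =
          [set x | \sum_i x i - 1 = 0].
  apply/seteqP; split=> x /= => [->|/eqP]; first exact: subrr.
  by rewrite subr_eq0 => /eqP.
apply: (polyhedral_eq0 (g := fun x : {ffun I -> R^o} => \sum_i x i - 1)).
by apply: affine_add; [apply: affine_sum | apply: affine_cst].
Qed.

End Affine.

(** * Piecewise linear maps *)

Section PLMaps.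
Variable R : realType.
Implicit Types U V W : lmodType R.

(** A PL structure on the identity is a finite cover by convex polyhedral sets;
with this encoding, restricting a PL map to a polyhedron is composing it with a
PL map. *)
Definition polyhedron U (A : set U) := pl_map A (@id U).

(** Pieces indexed by part of an arbitrary finite type, which saves enumerating
pairs, sums and chains by ordinals. *)
Lemma pl_map_fin U V (I : finType) (D : set I) (C : I -> set U)
    (A : set U) (f : U -> V) :
    (forall i, D i -> convex_polyhedral (C i)) ->
    A = \bigcup_(i in D) C i ->
    (forall i, D i -> exists2 g : U -> V,
       affine_map g & forall x, C i x -> f x = g x) ->
  pl_map A f.
Proof.
move=> pC -> fC.
pose e (k : 'I_#|[pred i | `[< D i >]]|) := enum_val k.
have De k : D (e k) by apply/asboolP; exact: (enum_valP k).
exists _, (C \o e); split=> [k||k]; [exact: pC| |exact: fC].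
apply/seteqP; split=> [x [i Di Cx]|x [k _ Cx]]; last by exists (e k).
have iD : i \in [pred i | `[< D i >]] by apply/asboolP.
by exists (enum_rank_in iD i); rewrite //= /e enum_rankK_in.
Qed.

Lemma pl_map_eq U V (A : set U) (f g : U -> V) :
  (forall x, A x -> f x = g x) -> pl_map A f -> pl_map A g.
Proof.
move=> fg [n [C [pC AE fC]]]; exists n, C; split=> // i.
have [k ak fk] := fC i; exists k => // x Cx; rewrite -fg ?fk //.
by rewrite AE; exists i.
Qed.

Lemma pl_map_affine U V (A : set U) (f : U -> V) :
  polyhedron A -> affine_map f -> pl_map A f.
Proof. by move=> [n [C [pC AE _]]] af; exists n, C; split=> // i; exists f. Qed.

(** The pieces of a composite are those of [f] cut by the preimages of those of
[g]; such a preimage is polyhedral because [f] is affine on the piece. *)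
Lemma pl_map_comp U V W (A : set U) (B : set V) (f : U -> V) (g : V -> W) :
  pl_map A f -> pl_map B g -> (forall x, A x -> B (f x)) ->
  pl_map A (g \o f).
Proof.
move=> [m [C [pC AE fC]]] [n [D [pD BE gD]]] fAB.
apply: (@pl_map_fin _ _ ('I_m * 'I_n)%type setT
          (fun k => C k.1 `&` f @^-1` D k.2)).
- move=> [i j] _ /=; have [k ak fk] := fC i.
  have -> : C i `&` f @^-1` D j = C i `&` k @^-1` D j.
    by apply/seteqP; split=> x /= [Cx Dx]; split=> //; move: Dx; rewrite fk.
  by apply: polyhedralI => //; apply: polyhedral_preimage.
- apply/seteqP; split=> [x Ax|x [[i j] _ [Cx _]]]; last by rewrite AE; exists i.
  have := fAB x Ax; rewrite BE => -[j _ Dfx].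
  by move: Ax; rewrite AE => -[i _ Cx]; exists (i, j).
- move=> [i j] _ /=; have [k ak fk] := fC i; have [l al gl] := gD j.
  exists (l \o k); first exact: affine_comp.
  by move=> x [Cx Dfx] /=; rewrite gl // fk.
Qed.

Lemma pl_map_sub U V (A B : set U) (f : U -> V) :
  polyhedron B -> B `<=` A -> pl_map A f -> pl_map B f.
Proof. by move=> pB BA pf; apply: (pl_map_comp pB pf). Qed.

Lemma pl_map_union U V (A B : set U) (f : U -> V) :
  pl_map A f -> pl_map B f -> pl_map (A `|` B) f.
Proof.
move=> [m [C [pC -> fC]]] [n [D [pD -> fD]]].
apply: (@pl_map_fin _ _ ('I_m + 'I_n)%type setT
          (fun k => match k with inl i => C i | inr j => D j end)).
- by case.
- apply/seteqP; split=> [x [[i _ Cx]|[j _ Dx]]|x [[i|j] _ Ex]].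
  + by exists (inl i).
  + by exists (inr j).
  + by left; exists i.
  + by right; exists j.
- by case.
Qed.

(** Carrying the inverse along as data makes every construction below symmetric:
whatever holds for [f] holds for [g] by exchanging the two sides. *)
Definition pl_iso U V (A : set U) (B : set V) (f : U -> V) (g : V -> U) :
    Prop :=
  [/\ forall x, A x -> B (f x), forall y, B y -> A (g y),
      forall x, A x -> g (f x) = x, forall y, B y -> f (g y) = y &
      pl_map A f /\ pl_map B g].

Lemma pl_homeoP U V (A : set U) (B : set V) (f : U -> V) :
  pl_homeo A B f <-> exists g, pl_iso A B f g.
Proof.
split=> [[[fAB _ fsurj] pf [g pg gf]]|[g [fAB gBA gf fg [pf pg]]]].
  exists g; split=> [|y /fsurj[x Ax <-]||y /fsurj[x Ax <-]|] //.
    by rewrite gf.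
  by rewrite gf.
split=> //; last by exists g.
split=> [x Ax|x y|y By]; first exact: fAB.
  by rewrite !inE => Ax Ay fxy; rewrite -(gf x) // fxy gf.
by exists (g y); [exact: gBA | exact: fg].
Qed.

Lemma pl_iso_sym U V (A : set U) (B : set V) (f : U -> V) (g : V -> U) :
  pl_iso A B f g -> pl_iso B A g f.
Proof. by move=> [? ? ? ? []]; split. Qed.

Lemma pl_iso_comp U V W (A : set U) (B : set V) (C : set W)
    (f : U -> V) (f' : V -> U) (g : V -> W) (g' : W -> V) :
  pl_iso A B f f' -> pl_iso B C g g' -> pl_iso A C (g \o f) (f' \o g').
Proof.
move=> [fAB fBA fK f'K [pf pf']] [gBC gCB gK g'K [pg pg']]; split=> /=.
- by move=> x /fAB /gBC.
- by move=> x /gCB /fBA.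
- by move=> x Ax; rewrite gK ?fK //; apply: fAB.
- by move=> x Cx; rewrite f'K ?g'K //; apply: gCB.
- by split; [exact: (pl_map_comp pf pg) | exact: (pl_map_comp pg' pf')].
Qed.

Lemma pl_iso_sub U V (A A' : set U) (B B' : set V) (f : U -> V) (g : V -> U) :
  pl_iso A B f g -> polyhedron A' -> polyhedron B' ->
  A' `<=` A -> B' `<=` B ->
  (forall x, A' x -> B' (f x)) -> (forall y, B' y -> A' (g y)) ->
  pl_iso A' B' f g.
Proof.
move=> [_ _ gf fg [pf pg]] pA' pB' sA sB fA' gB'; split=> // [x|y|].
- by move=> /sA /gf.
- by move=> /sB /fg.
- by split; [apply: pl_map_sub pf | apply: pl_map_sub pg].
Qed.

Definition glue U V (A : set U) (f1 f2 : U -> V) (x : U) : V :=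
  if `[< A x >] then f1 x else f2 x.

Lemma glue_l U V (A : set U) (f1 f2 : U -> V) x :
  A x -> glue A f1 f2 x = f1 x.
Proof. by move=> Ax; rewrite /glue asboolT. Qed.

Lemma glue_r U V (A B : set U) (f1 f2 : U -> V) x :
  (forall x, A x -> B x -> f1 x = f2 x) -> B x -> glue A f1 f2 x = f2 x.
Proof. by move=> f12 Bx; rewrite /glue; case: asboolP => // Ax; apply: f12. Qed.

Lemma pl_map_glue U V (A B : set U) (f1 f2 : U -> V) :
  pl_map A f1 -> pl_map B f2 -> (forall x, A x -> B x -> f1 x = f2 x) ->
  pl_map (A `|` B) (glue A f1 f2).
Proof.
move=> pf1 pf2 f12; apply: pl_map_union.
  by apply: pl_map_eq pf1 => x Ax; rewrite glue_l.
by apply: pl_map_eq pf2 => x Bx; rewrite (glue_r f12).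
Qed.

Lemma pl_iso_glue U V (A B : set U) (A' B' : set V)
    (f1 f2 : U -> V) (g1 g2 : V -> U) :
  pl_iso A A' f1 g1 -> pl_iso B B' f2 g2 ->
  (forall x, A x -> B x -> f1 x = f2 x) ->
  (forall y, A' y -> B' y -> g1 y = g2 y) ->
  pl_iso (A `|` B) (A' `|` B') (glue A f1 f2) (glue A' g1 g2).
Proof.
move=> [fA gA gf1 fg1 [pf1 pg1]] [fB gB gf2 fg2 [pf2 pg2]] f12 g12.
have fl := @glue_l _ _ A f1 f2; have fr := fun x => @glue_r _ _ A B f1 f2 x f12.
have gl := @glue_l _ _ A' g1 g2.
have gr := fun y => @glue_r _ _ A' B' g1 g2 y g12.
split.
- by move=> x [Ax|Bx];
    [left; rewrite fl //; apply: fA | right; rewrite fr //; apply: fB].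
- by move=> y [Ay|By];
    [left; rewrite gl //; apply: gA | right; rewrite gr //; apply: gB].
- move=> x [Ax|Bx]; first by rewrite fl // gl ?gf1 //; apply: fA.
  by rewrite fr // gr ?gf2 //; apply: fB.
- move=> y [Ay|By]; first by rewrite gl // fl ?fg1 //; apply: gA.
  by rewrite gr // fr ?fg2 //; apply: gB.
- by split; apply: pl_map_glue.
Qed.

End PLMaps.

(** * Cones in barycentric coordinates *)

Section Cones.
Variable R : realType.

Definition simplex (I : finType) : set {ffun I -> R^o} :=
  [set x | (forall i, 0 <= x i) /\ \sum_i x i = 1].

Definition vertex (I : finType) (v : I) : {ffun I -> R^o} :=
  [ffun i => (i == v)%:R : R^o].

(** The radial projection from the vertex [v] onto the opposite face. At the
vertex the inverse of zero is zero, so the value there is zero. *)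
Definition base (I : finType) (v : I) (z : {ffun I -> R^o}) : {ffun I -> R^o} :=
  (1 - z v : R)^-1 *: (z - (z v : R) *: vertex v).

Definition join (I : finType) (v : I) (t : R) (y : {ffun I -> R^o}) :
    {ffun I -> R^o} :=
  t *: vertex v + (1 - t) *: y.

(** The map of cones that agrees with [f] on the base, sends apex to apex and is
linear on every ray. *)
Definition cone_map (I J : finType) (v : I) (w : J)
    (f : {ffun I -> R^o} -> {ffun J -> R^o}) (z : {ffun I -> R^o}) :
    {ffun J -> R^o} :=
  join w (z v) (f (base v z)).

Section Simplex.
Variables (I : finType) (v : I).
Implicit Types (y z : {ffun I -> R^o}) (t : R).

Lemma simplex_le1 z : simplex z -> z v <= 1.
Proof.
move=> [z0 <-]; rewrite (bigD1 v) //= lerDl; exact: sumr_ge0.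
Qed.

Lemma simplex_eq1 z : simplex z -> z v = 1 -> z = vertex v.
Proof.
move=> [z0 z1] zv; apply/ffunP => i; rewrite ffunE.
have [->|iv] := eqVneq i v; first exact: zv.
move: z1; rewrite (bigD1 v) //= zv => /(canRL (addKr _)); rewrite addNr => s0.
exact: (psumr_eq0P (fun j _ => z0 j) s0).
Qed.

Lemma vertex_id : vertex v v = 1.
Proof. by rewrite ffunE eqxx. Qed.

Lemma sum_vertex : \sum_i vertex v i = 1.
Proof.
rewrite (bigD1 v) //= vertex_id big1 ?addr0 // => i /negbTE iv.
by rewrite ffunE iv.
Qed.

Lemma vertex_simplex : simplex (vertex v).
Proof. by split=> [i|]; rewrite ?sum_vertex // ffunE ler0n. Qed.

Lemma joinE t y i : join v t y i = t * (i == v)%:R + (1 - t) * y i.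
Proof. by rewrite !ffunE. Qed.

Lemma join_id t y : y v = 0 -> join v t y v = t.
Proof. by move=> yv; rewrite joinE eqxx yv mulr1 mulr0 addr0. Qed.

Lemma join1 y : join v 1 y = vertex v.
Proof. by rewrite /join subrr scale0r scale1r addr0. Qed.

Lemma join0 y : join v 0 y = y.
Proof. by rewrite /join scale0r subr0 scale1r add0r. Qed.

Lemma join_simplex t y : 0 <= t -> t <= 1 -> simplex y -> simplex (join v t y).
Proof.
move=> t0 t1 [y0 y1]; split=> [i|].
  by rewrite joinE addr_ge0 // mulr_ge0 ?ler0n ?subr_ge0 //; apply: y0.
under eq_bigr do rewrite joinE.
have v1 : \sum_i (i == v)%:R = 1 :> R.
  by rewrite -[RHS]sum_vertex; apply: eq_bigr => i _; rewrite ffunE.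
by rewrite big_split /= -!mulr_sumr v1 y1 !mulr1 addrC subrK.
Qed.

Lemma base_join t y : y v = 0 -> t != 1 -> base v (join v t y) = y.
Proof.
move=> yv t1; rewrite /base join_id // /join addrAC subrr add0r scalerA.
rewrite mulVf ?scale1r //.
by rewrite subr_eq0 eq_sym.
Qed.

Lemma join_base z : simplex z -> join v (z v) (base v z) = z.
Proof.
move=> sz; have [zv|zv] := eqVneq (z v) 1.
  by rewrite zv join1 -(simplex_eq1 sz zv).
rewrite /join /base scalerA mulfV ?subr_eq0 1?eq_sym // scale1r.
by rewrite addrC subrK.
Qed.

Lemma baseE z i : base v z i = (1 - z v)^-1 * (z i - z v * (i == v)%:R).
Proof. by rewrite !ffunE. Qed.

Lemma base_id z : base v z v = 0.
Proof. by rewrite baseE eqxx mulr1 subrr mulr0. Qed.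

Lemma base_off z i : i != v -> base v z i = (1 - z v)^-1 * z i.
Proof. by move=> /negbTE iv; rewrite baseE iv mulr0 subr0. Qed.

Lemma base_simplex z : simplex z -> z v != 1 -> simplex (base v z).
Proof.
move=> sz zv.
have zlt : 0 < 1 - z v by rewrite subr_gt0 lt_neqAle zv simplex_le1.
have [z0 z1] := sz; split=> [i|].
  have [->|iv] := eqVneq i v; first by rewrite base_id.
  by rewrite base_off //; apply: mulr_ge0 => //; rewrite invr_ge0 ltW.
rewrite (bigD1 v) //= base_id add0r.
under eq_bigr => i iv do rewrite base_off //.
rewrite -mulr_sumr; move: z1; rewrite (bigD1 v) //= => /(canRL (addKr _)) ->.
by rewrite [- _ + 1]addrC mulVf // gt_eqF.
Qed.

(** If [g y] is [L y + c], then the right-hand side is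
[L (z - z v *: vertex v) + (1 - z v) *: c]: the factor [1 - z v] clears the
denominator of [base], and both sides vanish at the apex. *)
Lemma affine_homogenize (W : lmodType R) (g : {ffun I -> R^o} -> W) :
  affine_map g -> exists2 h : {ffun I -> R^o} -> W,
    affine_map h & forall z, simplex z -> h z = (1 - z v) *: g (base v z).
Proof.
move=> [L [c gE]].
have affine_cov : affine_map (fun z : {ffun I -> R^o} => (1 - z v : R^o)).
  by apply: affine_add; [exact: affine_cst | exact/affine_opp/affine_coord].
exists (fun z => L (z - (z v : R) *: vertex v) + (1 - z v : R) *: c).
  apply: affine_add; last exact: affine_scale.
  have aL : affine_map L by exists L, 0 => x; rewrite addr0.
  apply: (affine_comp aL); apply: affine_add.
    by apply: affine_linear => a x y.
  exact/affine_opp/affine_scale/affine_coord.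
move=> z sz; rewrite gE scalerDr; congr (_ + _); rewrite -linearZ; congr (L _).
by rewrite -{1}(join_base sz) /join addrAC subrr add0r.
Qed.

End Simplex.

(** The cone over a piece of [f] is again a piece, cut out by the homogenized
inequalities, and on it the cone of [f] is given by the homogenized affine map.
All of these pieces share the apex, which gets one further piece for the sake of
an empty base. *)
Lemma pl_map_cone (I J : finType) (v : I) (w : J)
    (A : set {ffun I -> R^o}) (f : {ffun I -> R^o} -> {ffun J -> R^o}) :
  pl_map A f ->
  pl_map [set z | simplex z /\ (z v = 1 \/ A (base v z))] (cone_map v w f).
Proof.
move=> [n [C [pC -> fC]]].
have polyhedral_apex :
    convex_polyhedral [set z : {ffun I -> R^o} | simplex z /\ z v = 1].
  apply: (polyhedralI (B := [set z : {ffun I -> R^o} | z v = 1])).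
    exact: polyhedral_simplex.
  have -> : [set z : {ffun I -> R^o} | z v = 1] =
            [set z : {ffun I -> R^o} | (z v - 1 : R^o) = 0].
    apply/seteqP; split=> z /= => [->|/eqP]; first exact: subrr.
    by rewrite subr_eq0 => /eqP.
  apply: polyhedral_eq0; apply: affine_add; [exact: affine_coord|].
  exact: affine_cst.
pose K (o : option 'I_n) := if o is Some i
  then [set z : {ffun I -> R^o} | simplex z /\ (z v = 1 \/ C i (base v z))]
  else [set z : {ffun I -> R^o} | simplex z /\ z v = 1].
apply: (@pl_map_fin _ _ _ (option 'I_n) setT K) => [[i|] _ //||[i|] _].
- have [m [g [ag CE]]] := pC i.
  have /boolp.choice[h hE] : forall j : 'I_m, exists h : {ffun I -> R^o} -> R^o,
      affine_map h /\ forall z, simplex z -> h z = (1 - z v) *: g j (base v z).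
    by move=> j; have [h ah hE] := affine_homogenize v (ag j); exists h.
  have -> : K (Some i) = simplex (I := I) `&` [set z | forall j, 0 <= h j z].
    apply/seteqP; split=> z [sz].
      move=> zC; split=> // j; rewrite (hE j).2 //.
      case: zC => [->|]; first by rewrite subrr scale0r.
      rewrite CE => /(_ j) gz; apply: mulr_ge0 => //.
      by rewrite subr_ge0 simplex_le1.
    move=> /= hz; split=> //; have [zv|zv] := eqVneq (z v) 1; [by left | right].
    rewrite CE => j; have := hz j; rewrite (hE j).2 // pmulr_rge0 //.
    by rewrite subr_gt0 lt_neqAle zv simplex_le1.
  apply: polyhedralI; first exact: polyhedral_simplex.
  by apply: polyhedral_fin => j; exact: (hE j).1.
- apply/seteqP; split=> [z [sz [zv|[i _ Cz]]]|z [[i|] _]].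
  + by exists None.
  + by exists (Some i) => //; split=> //; right.
  + by move=> [sz [zv|Cz]]; split=> //; [left | right; exists i].
  + by move=> [sz zv]; split=> //; left.
- have [g ag fg] := fC i; have [h ah hE] := affine_homogenize v ag.
  exists (fun z : {ffun I -> R^o} => (z v : R) *: vertex w + h z).
    by apply: affine_add => //; apply/affine_scale/affine_coord.
  move=> z [sz zC]; rewrite hE //; congr (_ + _).
  by case: zC => [->|/fg -> //]; rewrite subrr !scale0r.
- exists (fun=> vertex w); first exact: affine_cst.
  by move=> z [_ zv]; rewrite /cone_map zv join1.
Qed.

End Cones.

(** * Realizations of posets *)

Section Realizations.
Variable R : realType.

Lemma chain_subset d (P : finPOrderType d) (c e : {set P}) :
  c \subset e -> is_chain e -> is_chain c.
Proof. by move=> /fintype.subsetP ce che p q /ce pe /ce qe; apply: che. Qed.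

Lemma realization_simplex d (P : finPOrderType d) (Q : {set P}) x :
  realization R Q x -> simplex x.
Proof. by case. Qed.

Lemma realization_off d (P : finPOrderType d) (Q : {set P}) x p :
  realization R Q x -> p \notin Q -> x p = 0.
Proof.
move=> [_ _ /fintype.subsetP sxQ _]; apply: contraNeq => xp.
by apply: sxQ; rewrite inE.
Qed.

Lemma realizationS d (P : finPOrderType d) (Q Q' : {set P}) :
  Q \subset Q' -> realization R Q `<=` realization R Q'.
Proof.
by move=> QQ' x [? ? xQ ?]; split=> //; apply: fintype.subset_trans QQ'.
Qed.

Lemma bary_supp_neq0 d (P : finPOrderType d) (Q : {set P}) x :
  realization R Q x -> exists p, p \in bary_supp x.
Proof.
move=> [_ x1 _ _]; apply/finset.set0Pn; apply/eqP => x0.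
suff /eqP : (0 : R) = 1 by rewrite eq_sym oner_eq0.
rewrite -[RHS]x1; apply/esym/big1 => p _; apply/eqP.
by have /setP/(_ p) := x0; rewrite !inE => /negbFE.
Qed.

Lemma realization_set0 d (P : finPOrderType d) :
  realization R (finset.set0 : {set P}) = set0.
Proof.
apply/seteqP; split=> // x xr; have [p] := bary_supp_neq0 xr.
by rewrite inE (realization_off xr) ?eqxx // inE.
Qed.

Lemma realizationI d (P : finPOrderType d) (Q Q' : {set P}) :
  realization R Q `&` realization R Q' = realization R (Q :&: Q')%SET.
Proof.
apply/seteqP; split=> [x [[x0 x1 xQ xc] [_ _ xQ' _]]|x [x0 x1]].
  by split=> //; rewrite finset.subsetI xQ.
by rewrite finset.subsetI => /andP[xQ xQ'] xc.
Qed.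

(** The pieces are the closed simplices spanned by the chains of [Q]. On the
standard simplex, a coordinate vanishes as soon as its opposite is
nonnegative. *)
Lemma polyhedron_realization d (P : finPOrderType d) (Q : {set P}) :
  polyhedron (realization R Q).
Proof.
pose face (c : {set P}) : set {ffun P -> R^o} :=
  simplex (I := P) `&` [set x | forall p, 0 <= if p \in c then 0 else - x p].
have faceE c x : face c x <-> simplex x /\ bary_supp x \subset c.
  split=> [[sx xc]|[sx /fintype.subsetP xc]]; split=> //.
    apply/fintype.subsetP => p; rewrite inE; apply: contraNT => pc; have := xc p.
    by rewrite (negbTE pc) oppr_ge0 => xp; rewrite eq_le xp sx.1.
  move=> p; case: ifPn => // pc; have := contraNN (xc p) pc.
  by rewrite inE negbK => /eqP ->; rewrite oppr0.
apply: (@pl_map_fin _ _ _ {set P} [set c | is_chain c /\ c \subset Q] face).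
- move=> c _; apply: polyhedralI; first exact: polyhedral_simplex.
  apply: polyhedral_fin => p; case: (p \in c); first exact: affine_cst.
  exact/affine_opp/affine_coord.
- apply/seteqP; split=> [x [x0 x1 xQ xc]|x [c [cc cQ] /faceE[[x0 x1] xc]]].
    by exists (bary_supp x) => //; apply/faceE.
  by split=> //; [exact: fintype.subset_trans cQ | exact: chain_subset cc].
- by move=> c _; exists id => //; apply: affine_linear.
Qed.

Section ConeOverBoundary.
Context {d : Order.disp_t} {P : finPOrderType d}.
Variables (X : {set P}) (v : P).
Hypothesis ltXv : forall x, x \in X -> (x < v)%O.

Lemma apex_notin : v \notin X.
Proof. by apply/negP => /ltXv; rewrite ltxx. Qed.

(** As [v] is comparable with every element of [X], adding it to the support of
a point or removing it keeps the support a chain. *)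
Lemma realization_cone z :
  realization R (v |: X)%SET z <->
  simplex z /\ (z v = 1 \/ realization R X (base v z)).
Proof.
split=> [zr|[sz zX]].
  have sz := realization_simplex zr; split=> //.
  have [zv|zv] := eqVneq (z v) 1; [by left | right].
  have [b0 b1] := base_simplex sz zv; have [_ _ /fintype.subsetP zX zc] := zr.
  have bz p : p \in bary_supp (base v z) -> p != v /\ p \in bary_supp z.
    rewrite !inE; have [->|pv] := eqVneq p v; first by rewrite base_id eqxx.
    by rewrite base_off // mulf_eq0 negb_or => /andP[].
  split=> //; last by apply: chain_subset zc; apply/fintype.subsetP => p /bz[].
  apply/fintype.subsetP => p /bz[pv /zX].
  by rewrite !inE (negbTE pv).
have [z0 z1] := sz.
have zb p : p \in bary_supp z -> p != v ->
    p \in X /\ p \in bary_supp (base v z).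
  rewrite inE => zp pv; case: zX => [zv|bX].
    by move: zp; rewrite (simplex_eq1 sz zv) ffunE (negbTE pv) eqxx.
  have pb : p \in bary_supp (base v z).
    rewrite inE base_off // mulf_neq0 // invr_eq0 subr_eq0 eq_sym.
    apply: contraNneq zp => zv.
    by rewrite (simplex_eq1 sz zv) ffunE (negbTE pv).
  by split=> //; case: bX => _ _ /fintype.subsetP /(_ p pb).
have pX p : p \in bary_supp z -> (p <= v)%O.
  move=> pz; have [-> //|pv] := eqVneq p v.
  by apply/ltW/ltXv; have [] := zb p pz pv.
split=> //.
  apply/fintype.subsetP => p pz; rewrite !inE; have [//|pv] := eqVneq p v.
  by have [] := zb p pz pv.
move=> p q pz qz.
have [->|pv] := eqVneq p v; first by rewrite /Order.comparable pX // orbT.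
have [->|qv] := eqVneq q v; first by rewrite /Order.comparable pX.
have [pX' pb] := zb p pz pv; have [_ qb] := zb q qz qv.
case: zX => [zv|[_ _ _ bc]]; last exact: bc.
by move: pz; rewrite inE (simplex_eq1 sz zv) ffunE (negbTE pv) eqxx.
Qed.

Lemma base_realization x : realization R X x -> x v = 0 /\ base v x = x.
Proof.
move=> xr; have xv : x v = 0 := realization_off xr apex_notin.
by split=> //; rewrite /base xv subr0 invr1 scale0r subr0 scale1r.
Qed.

End ConeOverBoundary.

(** Coning is functorial, so the cone of an isomorphism is an isomorphism.
Exchanging the two sides turns the first half of the proof into the second. *)
Lemma pl_iso_cone d (P : finPOrderType d) d' (P' : finPOrderType d')
    (X : {set P}) (v : P) (Y : {set P'}) (w : P') f g :
  (forall x, x \in X -> (x < v)%O) -> (forall y, y \in Y -> (y < w)%O) ->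
  pl_iso (realization R X) (realization R Y) f g ->
  pl_iso (realization R (v |: X)%SET) (realization R (w |: Y)%SET)
    (cone_map v w f) (cone_map w v g).
Proof.
have half e (S : finPOrderType e) e' (T : finPOrderType e')
    (A : {set S}) (a : S) (B : {set T}) (b : T) h k :
    (forall x, x \in A -> (x < a)%O) -> (forall y, y \in B -> (y < b)%O) ->
    pl_iso (realization R A) (realization R B) h k ->
  [/\ forall z, realization R (a |: A)%SET z ->
        realization R (b |: B)%SET (cone_map a b h z),
      forall z, realization R (a |: A)%SET z ->
        cone_map b a k (cone_map a b h z) = z &
      pl_map (realization R (a |: A)%SET) (cone_map a b h)].
  move=> ltAa ltBb [hAB _ kh _ [ph _]].
  have hb y : realization R B y -> y b = 0.
    by move=> /(base_realization ltBb)[].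
  split=> [z|z|].
  - move=> /(realization_cone ltAa)[sz]; have [zv _|zv] := eqVneq (z a) 1.
      rewrite /cone_map zv join1 => //; apply/(realization_cone ltBb).
      by split; [exact: vertex_simplex | left; rewrite vertex_id].
    case=> [/eqP|/hAB bB]; first by rewrite (negbTE zv).
    apply/(realization_cone ltBb); split.
      apply: join_simplex; first exact: sz.1.
        exact: simplex_le1.
      exact: realization_simplex bB.
    by right; rewrite /cone_map base_join // hb.
  - move=> /(realization_cone ltAa)[sz]; have [zv _|zv] := eqVneq (z a) 1.
      rewrite (simplex_eq1 sz zv) /cone_map !vertex_id !join1.
      by rewrite vertex_id join1.
    case=> [/eqP|zA]; first by rewrite (negbTE zv).
    have bB := hAB _ zA.
    rewrite /cone_map base_join ?join_id ?hb // kh //.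
    exact: join_base.
  - have -> : realization R (a |: A)%SET =
        [set z | simplex z /\ (z a = 1 \/ realization R A (base a z))].
      by apply/seteqP; split=> z /(realization_cone ltAa).
    exact: pl_map_cone.
move=> ltXv ltYw fg.
have [? ? ?] := half _ _ _ _ _ _ _ _ _ _ ltXv ltYw fg.
by have [? ? ?] := half _ _ _ _ _ _ _ _ _ _ ltYw ltXv (pl_iso_sym fg); split.
Qed.

Lemma cone_map_base d (P : finPOrderType d) (J : finType)
    (X : {set P}) (v : P) (w : J) f x :
  (forall x, x \in X -> (x < v)%O) ->
  realization R X x -> cone_map v w f x = f x.
Proof.
move=> ltXv xr; have [xv bx] := base_realization ltXv xr.
by rewrite /cone_map xv bx join0.
Qed.

(** The inverse of [cone_incl] on the base: forgetting the coordinate of the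
apex. *)
Definition cone_proj (T : finType) (y : {ffun cone T -> R^o}) :
    {ffun T -> R^o} :=
  [ffun p => y (Some p)].

Lemma sum_cone (T : finType) (F : cone T -> R) :
  \sum_a F a = F None + \sum_p F (Some p).
Proof.
rewrite (bigD1 None) //=; congr (_ + _).
rewrite (reindex_omap Some id) /=; last by case.
by apply: eq_bigl => p; rewrite eqxx.
Qed.

Lemma pl_iso_cone_incl d (P : finPOrderType d) (X : {set P}) :
  pl_iso (realization R X)
    (realization R ([set Some p | p in X]%SET : {set cone P}))
    (@cone_incl _ P R) (@cone_proj P).
Proof.
have None_coord y :
    realization R ([set Some p | p in X]%SET : {set cone P}) y -> y None = 0.
  by move=> yr; apply: (realization_off yr); apply/imsetP => -[].
have incl_supp (x : {ffun P -> R^o}) a :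
    a \in bary_supp (cone_incl x) -> exists2 p, p \in bary_supp x & a = Some p.
  rewrite inE ffunE; case: a => [p xp|]; last by rewrite eqxx.
  by exists p; rewrite ?inE.
split.
- move=> x [x0 x1 /fintype.subsetP xX xc]; split.
  + by case=> [p|]; rewrite ffunE.
  + rewrite sum_cone ffunE add0r -[RHS]x1.
    by apply: eq_bigr => p _; rewrite ffunE.
  + by apply/fintype.subsetP => a /incl_supp[p /xX pX ->]; apply: imset_f.
  + move=> a b /incl_supp[p ps ->] /incl_supp[q qs ->]; exact: xc ps qs.
- move=> y yr; have [y0 y1 /fintype.subsetP yX yc] := yr.
  have proj_supp p : p \in bary_supp (cone_proj y) -> Some p \in bary_supp y.
    by rewrite !inE ffunE.
  split.
  + by move=> p; rewrite ffunE.
  + move: y1; rewrite sum_cone None_coord // add0r => <-.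
    by apply: eq_bigr => p _; rewrite ffunE.
  + apply/fintype.subsetP => p /proj_supp /yX /imsetP[q qX [->]]; exact: qX.
  + move=> p q /proj_supp ps /proj_supp qs; exact: yc ps qs.
- by move=> x _; apply/ffunP => p; rewrite !ffunE.
- move=> y yr; apply/ffunP => -[p|]; rewrite !ffunE //.
  by rewrite None_coord.
- split; apply: pl_map_affine; try exact: polyhedron_realization.
    apply: affine_linear => a x y; apply/ffunP => -[p|]; rewrite !ffunE //.
    by rewrite scaler0 addr0.
  by apply: affine_linear => a x y; apply/ffunP => p; rewrite !ffunE.
Qed.

Lemma lt_cone_apex d (P : finPOrderType d) (X : {set P}) (a : cone P) :
  a \in ([set Some p | p in X]%SET : {set cone P}) -> (a < None)%O.
Proof. by move=> /imsetP[p _ ->]. Qed.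

End Realizations.

(** * Monotone maps and down-sets *)

Section DownSets.
Context {d : Order.disp_t} {P : finPOrderType d}.

Definition down_closed (Q : {set P}) : Prop :=
  forall p q, (q <= p)%O -> p \in Q -> q \in Q.

Lemma down_closed_principal (p : P) : down_closed (principal p).
Proof. by move=> q r rq; rewrite !inE; apply: le_trans. Qed.

Lemma down_closed_boundary (p : P) : down_closed (boundary p).
Proof. by move=> q r rq; rewrite !inE; apply: le_lt_trans. Qed.

Lemma principalE (p : P) : principal p = (p |: boundary p)%SET.
Proof. by apply/setP => q; rewrite !inE le_eqVlt. Qed.

Lemma preimset_id (Q : {set P}) : (id @^-1: Q)%SET = Q.
Proof. by apply/setP => q; rewrite inE. Qed.

Lemma id_monotone : {homo @id P : x y / (x <= y)%O >-> (x <= y)%O}.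
Proof. by []. Qed.

Lemma exists_maximal (Q : {set P}) q0 :
  q0 \in Q -> exists2 p, p \in Q & forall q, q \in Q -> ~~ (p < q)%O.
Proof.
move=> q0Q; case: (@arg_maxnP _ q0 (mem Q) (fun p => #|principal p|) q0Q).
move=> p pQ pmax; exists p => // q qQ; apply/negP => pq.
have := pmax q qQ; rewrite /= leqNgt => /negP; apply; apply: proper_card.
apply/fintype.properP; split.
  by apply/fintype.subsetP => r; rewrite !inE => rp; apply: le_trans (ltW pq).
by exists q; rewrite !inE ?lexx // lt_geF.
Qed.

Lemma principal_subset (Q : {set P}) q :
  down_closed Q -> q \in Q -> principal q \subset Q.
Proof.
by move=> dQ qQ; apply/fintype.subsetP => r; rewrite inE => /dQ; apply.
Qed.

End DownSets.

Section MonotonePreimage.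
Variable R : realType.
Context {d' d : Order.disp_t} {P' : finPOrderType d'} {P : finPOrderType d}.
Variable f : P' -> P.
Hypothesis f_monotone : {homo f : x y / (x <= y)%O >-> (x <= y)%O}.

(** The support of a point is a nonempty chain, so it lies below the image of
its greatest element. *)
Lemma realization_preim_cover (Q : {set P}) x :
  realization R (f @^-1: Q) x ->
  exists2 q, q \in Q & realization R (f @^-1: principal q) x.
Proof.
move=> xr; have [x0 x1 /fintype.subsetP xQ xc] := xr.
have [a0 /exists_maximal[a ax amax]] := bary_supp_neq0 xr.
exists (f a); first by have := xQ a ax; rewrite inE.
split=> //; apply/fintype.subsetP => b bx; rewrite !inE; apply: f_monotone.
have := xc _ _ bx ax; rewrite /Order.comparable => /orP[//|].
by rewrite le_eqVlt (negbTE (amax _ bx)) orbF => /eqP ->.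
Qed.

(** The image of a chain is a chain; if it contains the maximal element [p], all
of it lies below [p]. *)
Lemma realization_preim_split (Q : {set P}) p :
  down_closed Q -> p \in Q -> (forall q, q \in Q -> ~~ (p < q)%O) ->
  realization R (f @^-1: Q) =
  realization R (f @^-1: (Q :\ p)%SET) `|`
    realization R (f @^-1: principal p).
Proof.
move=> dQ pQ pmax; apply/seteqP; split=> [x [x0 x1 /fintype.subsetP xQ xc]|x].
  have [/existsP[a /andP[ax /eqP fa]]|/existsPn nofa] :=
      boolP [exists a, (a \in bary_supp x) && (f a == p)].
    right; split=> //; apply/fintype.subsetP => b bx; rewrite !inE.
    have := xc _ _ bx ax; rewrite /Order.comparable -fa.
    case/orP => /f_monotone //; rewrite le_eqVlt fa => /orP[/eqP -> //|].
    have := xQ b bx; rewrite inE => /pmax; by move=> /negbTE ->.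
  left; split=> //; apply/fintype.subsetP => b bx; rewrite !inE.
  by have := xQ b bx; have := nofa b; rewrite bx /= !inE => -> ->.
by move=> []; apply: realizationS; apply: preimsetS;
  [apply: finset.subsetDl | apply: principal_subset].
Qed.

Lemma realization_preim_meet (Q : {set P}) p :
  down_closed Q -> p \in Q ->
  realization R (f @^-1: (Q :\ p)%SET) `&`
    realization R (f @^-1: principal p) =
  realization R (f @^-1: boundary p).
Proof.
move=> dQ pQ; rewrite realizationI; congr realization.
apply/setP => a; rewrite !inE lt_neqAle.
case: (f a =P p) => //= _.
by case: (boolP (_ <= _)%O) => [/dQ ->|]; rewrite ?andbF.
Qed.

End MonotonePreimage.

(** * Stratified isomorphisms *)

Section Stratified.
Variable R : realType.
Context {d' d : Order.disp_t} {P' : finPOrderType d'} {P : finPOrderType d}.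
Variable f : P' -> P.
Hypothesis f_monotone : {homo f : x y / (x <= y)%O >-> (x <= y)%O}.

Local Notation pre Q := (realization R (f @^-1: Q)).

(** Two inclusions, one for each direction, in place of one equality of sets:
they say the same for mutually inverse maps, and each is inherited separately
by glued maps. *)
Definition stratified_iso (Q : {set P}) h g : Prop :=
  pl_iso (pre Q) (realization R Q) h g /\
  forall q, q \in Q ->
    (forall x, pre (principal q) x -> realization R (principal q) (h x)) /\
    (forall y, realization R (principal q) y -> pre (principal q) (g y)).

(** A down-set is the union of the principal down-sets that it contains, so
preserving these is enough. *)
Lemma stratified_iso_sub (Q Q0 : {set P}) h g :
  stratified_iso Q h g -> down_closed Q0 -> Q0 \subset Q ->
  pl_iso (pre Q0) (realization R Q0) h g.
Proof.
move=> [iso strat] dQ0 sQ0; have /fintype.subsetP inQ := sQ0.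
apply: (pl_iso_sub iso); try exact: polyhedron_realization.
- by apply: realizationS; apply: preimsetS.
- exact: realizationS.
- move=> x /(realization_preim_cover f_monotone)[q qQ0 xq].
  apply: (realizationS (principal_subset dQ0 qQ0)).
  exact: (strat q (inQ _ qQ0)).1.
- (* The case of the identity of [P] covers the realization of [Q0] itself. *)
  move=> y; rewrite -{1}[Q0]preimset_id.
  move=> /(realization_preim_cover id_monotone)[q qQ0].
  rewrite preimset_id => yq.
  apply: (realizationS (preimsetS f (principal_subset dQ0 qQ0))).
  exact: (strat q (inQ _ qQ0)).2.
Qed.

(** The homeomorphism at [p] is [h] followed by the cone of [g] over the
boundary of [p]. *)
Lemma stratified_iso_subdivision h g :
  stratified_iso [set: P]%SET h g -> subdivision_map R f.
Proof.
move=> strat p.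
have isop := stratified_iso_sub strat (@down_closed_principal _ _ p)
  (finset.subsetT _).
have isob := stratified_iso_sub strat (@down_closed_boundary _ _ p)
  (finset.subsetT _).
have ltp q : q \in boundary p -> (q < p)%O by rewrite inE.
have ltN := @lt_cone_apex _ P' (f @^-1: boundary p).
have isoc := pl_iso_cone ltp ltN
  (pl_iso_comp (pl_iso_sym isob) (pl_iso_cone_incl R (f @^-1: boundary p))).
rewrite -principalE in isoc.
exists (cone_map p None (@cone_incl _ P' R \o g) \o h).
  by apply/pl_homeoP; eexists; exact: (pl_iso_comp isop isoc).
move=> x xb; have [hb _ gh _ _] := isob.
by rewrite /= (cone_map_base _ _ ltp (hb _ xb)) /= gh.
Qed.

(** Induction on the size of [Q]: remove a maximal element [p], and glue the map
[h1] over the rest with [h2], the homeomorphism given at [p] followed by the cone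
of [h1] over the boundary of [p]. *)
Lemma subdivision_stratified_iso (Q : {set P}) :
  subdivision_map R f -> down_closed Q -> exists h g, stratified_iso Q h g.
Proof.
move=> sub_f dQ; have [n] := ubnP #|Q|; elim: n Q dQ => // n IHn Q dQ Qn.
have [->|/finset.set0Pn[q0 /exists_maximal[p pQ pmax]]] := eqVneq Q finset.set0.
  exists (fun=> 0), (fun=> 0); split=> [|q]; last by rewrite inE.
  have poly0 := polyhedron_realization R (f @^-1: finset.set0).
  have poly0' := polyhedron_realization R (finset.set0 : {set P}).
  split; try by move=> x; rewrite ?preimset0 realization_set0.
  by split; apply: pl_map_affine => //; exact: affine_cst.
have dQp : down_closed (Q :\ p)%SET.
  move=> q r rq; rewrite !inE => /andP[qp qQ]; rewrite (dQ _ _ rq qQ) andbT.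
  apply: contraNneq (pmax q qQ) => rp; move: rq; rewrite rp le_eqVlt eq_sym.
  by rewrite (negbTE qp).
have bQp : boundary p \subset (Q :\ p)%SET.
  apply/fintype.subsetP => q; rewrite !inE => qp; rewrite (lt_eqF qp) /=.
  exact: dQ (ltW qp) pQ.
have [|h1 [g1 strat1]] := IHn (Q :\ p)%SET dQp.
  by move: Qn; rewrite (cardsD1 p) pQ.
have isob := stratified_iso_sub strat1 (@down_closed_boundary _ _ p) bQp.
have [iso1 faces1] := strat1.
have [k /pl_homeoP[k' isok] kb] := sub_f p.
have ltp q : q \in boundary p -> (q < p)%O by rewrite inE.
have ltN := @lt_cone_apex _ P' (f @^-1: boundary p).
have isoi := pl_iso_cone_incl R (f @^-1: boundary p).
have isoc := pl_iso_cone ltN ltp (pl_iso_comp (pl_iso_sym isoi) isob).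
have iso2 := pl_iso_comp isok isoc; rewrite -principalE in iso2.
set h2 := cone_map _ _ _ \o k in iso2; set g2 := k' \o _ in iso2.
have h12 x : pre (Q :\ p)%SET x -> pre (principal p) x -> h1 x = h2 x.
  move=> xQ xp; have xb : pre (boundary p) x.
    by rewrite -(realization_preim_meet R f dQ pQ).
  have [incl _ projK _ _] := isoi.
  by rewrite /h2 /= kb // (cone_map_base _ _ ltN (incl _ xb)) /= projK.
have g12 y : realization R (Q :\ p)%SET y -> realization R (principal p) y ->
    g1 y = g2 y.
  move=> yQ yp; have yb : realization R (boundary p) y.
    have : (realization R (Q :\ p)%SET `&` realization R (principal p)) y by [].
    rewrite realizationI; apply: realizationS; apply/fintype.subsetP => q.
    by rewrite !inE lt_neqAle => /andP[/andP[-> _] ->].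
  have [_ gb _ _ _] := isob; have [_ _ kK _ _] := isok.
  rewrite /g2 /= (cone_map_base _ _ ltp yb) /= -kb; last exact: gb.
  rewrite kK //; apply: realizationS (gb _ yb); apply: preimsetS.
  by apply/fintype.subsetP => q; rewrite !inE => /ltW.
exists (glue (pre (Q :\ p)%SET) h1 h2).
exists (glue (realization R (Q :\ p)%SET) g1 g2).
split.
  rewrite (realization_preim_split R f_monotone dQ pQ pmax).
  have := realization_preim_split R id_monotone dQ pQ pmax.
  rewrite !preimset_id => ->; exact: pl_iso_glue iso1 iso2 h12 g12.
move=> q qQ; have [-> {q qQ}|qp] := eqVneq q p.
  have [hp gp _ _ _] := iso2.
  by split=> [x xp|y yp]; [rewrite (glue_r h12) //; exact: hp
                          |rewrite (glue_r g12) //; exact: gp].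
have qQp : q \in (Q :\ p)%SET by rewrite !inE qp.
have sq := principal_subset dQp qQp.
have [hq gq] := faces1 q qQp; split=> [x xq|y yq].
  by rewrite glue_l; [exact: hq | exact: realizationS (preimsetS f sq) _ xq].
by rewrite glue_l; [exact: gq | exact: realizationS sq _ yq].
Qed.

End Stratified.

(** * The characterization of subdivision maps *)

Theorem theorem11p2 (R : realType) (d' d : Order.disp_t)
    (P' : finPOrderType d') (P : finPOrderType d) (f : P' -> P)
    (f_monotone : {homo f : x y / (x <= y)%O >-> (x <= y)%O}) :
  subdivision_map R f <->
  exists2 h : {ffun P' -> R^o} -> {ffun P -> R^o},
    pl_homeo (realization R [set: P']%SET) (realization R [set: P]%SET) h &
    forall p : P,
      realization R [set: P']%SET `&` h @^-1` realization R (principal p) =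
      realization R (f @^-1: principal p).
Proof.
split=> [sub_f|[h /pl_homeoP[g iso] hpre]].
  have dT : down_closed [set: P]%SET by move=> p q _ _; rewrite inE.
  have [h [g [iso faces]]] := subdivision_stratified_iso f_monotone sub_f dT.
  rewrite preimsetT in iso; exists h; first by apply/pl_homeoP; exists g.
  move=> p; have [hp gp] := faces p (finset.in_setT p).
  have [_ _ gh _ _] := iso; apply/seteqP; split=> [x [xT hx]|x xp].
    by rewrite -(gh x xT); apply: gp.
  by split; [exact: realizationS (finset.subsetT _) _ xp | exact: hp].
apply: (stratified_iso_subdivision f_monotone (h := h) (g := g)).
split=> [|p _]; first by rewrite preimsetT.
split=> [x|y yp]; first by rewrite -hpre => -[].
have yT := realizationS (finset.subsetT (principal p)) yp.
by have [_ gT _ hg _] := iso; rewrite -hpre; split; [exact: gT | rewrite /= hg].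
Qed.
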